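(* Let $Y=[y_L,y_U]$ be a random interval with $\mathbf E(|y_L|+|y_U|)<\infty$. Let $\alpha\in(0,1)$ and assume $q_\alpha\in[T_Y^{-1}(\alpha),C_Y^{-1}(\alpha)]$. Then $\mathbf{Sel}_\alpha(Y\mid q_\alpha)\ne\emptyset$, and every $y\in\mathbf{Sel}_\alpha(Y\mid q_\alpha)$ satisfies $\mathbf E[y]\in[\mathbf E(y_L),\mathbf E(y_U)]$. In particular, $$\emptyset\ne\Theta_E(\alpha,q_\alpha)\subseteq[\mathbf E y_L,\mathbf E y_U].$$
   Context: $(\Omega,\mathcal A,\mathbf P)$ is a complete non-atomic probability space. A random interval is $Y(\omega)=[y_L(\omega),y_U(\omega)]\subset\mathbb R$ with $y_L,y_U$ measurable real-valued and $\mathbf P(y_L\le y_U)=1$. $\mathbf{Sel}(Y)$ is the set of measurable $y:\Omega\to\mathbb R$ with $y(\omega)\in Y(\omega)$ a.s. $T_Y((-\infty,t]):=\mathbf P(Y\cap(-\infty,t]\ne\emptyset)$, $C_Y((-\infty,t]):=\mathbf P(Y\subseteq(-\infty,t])$, $T_Y^{-1}(\alpha):=\inf\{t:T_Y((-\infty,t])\ge\alpha\}$, $C_Y^{-1}(\alpha):=\inf\{t:C_Y((-\infty,t])\ge\alpha\}$. With $F_y(t)=\mathbf P(y\le t)$ and $F_y^{-1}(\alpha)=\inf\{t:F_y(t)\ge\alpha\}$, put $\mathbf{Sel}_\alpha(Y\mid q_\alpha):=\{y\in\mathbf{Sel}(Y):F_y^{-1}(\alpha)=q_\alpha\}$ and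 $\Theta_E(\alpha,q_\alpha):=\{\mathbf E[y]:y\in\mathbf{Sel}_\alpha(Y\mid q_\alpha)\}$. *)

(* Defs.v *)
From HB Require Import structures.
From mathcomp Require Import all_boot all_order all_algebra.
From mathcomp Require Import all_classical all_reals all_analysis.

Set Implicit Arguments.
Unset Strict Implicit.
Unset Printing Implicit Defensive.
Import Order.TTheory GRing.Theory Num.Theory.
Local Open Scope classical_set_scope.
Local Open Scope ring_scope.
Local Open Scope ereal_scope.

Definition non_atomic (d : measure_display) (T : measurableType d)
    (R : realType) (P : probability T R) : Prop :=
  forall A : set T, measurable A -> 0 < P A ->
    exists B : set T, [/\ measurable B, B `<=` A, 0 < P B & P B < P A].

(* Empty at the points w where yU w < yL w. *)
Definition random_interval (T : Type) (R : realType) (yL yU : T -> R) :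
    T -> set R :=
  fun w => `[yL w, yU w]%classic.

Definition selections (d : measure_display) (T : measurableType d)
    (R : realType) (P : probability T R) (Y : T -> set R) :
    set {RV P >-> R} :=
  [set y : {RV P >-> R} | {ae P, forall w, Y w (y w)}].
Arguments selections {d T R} P Y _.

Definition capacity (d : measure_display) (T : measurableType d)
    (R : realType) (P : probability T R) (Y : T -> set R) (K : set R) : \bar R :=
  P [set w | Y w `&` K !=set0].

Definition containment (d : measure_display) (T : measurableType d)
    (R : realType) (P : probability T R) (Y : T -> set R) (K : set R) : \bar R :=
  P [set w | Y w `<=` K].

(* The infimum is taken in R: it is 0 by convention when the set is empty or
   unbounded below. For the distribution functions of finite real random
   variables and 0 < alpha < 1 this does not happen. *)
Definition generalized_inverse (R : realType) (G : R -> \bar R) (alpha : R) : R :=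
  inf [set t : R | alpha%:E <= G t].

Definition capacity_quantile (d : measure_display) (T : measurableType d)
    (R : realType) (P : probability T R) (Y : T -> set R) (alpha : R) : R :=
  generalized_inverse (fun t => capacity P Y `]-oo, t]%classic) alpha.

Definition containment_quantile (d : measure_display) (T : measurableType d)
    (R : realType) (P : probability T R) (Y : T -> set R) (alpha : R) : R :=
  generalized_inverse (fun t => containment P Y `]-oo, t]%classic) alpha.

Definition quantile (d : measure_display) (T : measurableType d)
    (R : realType) (P : probability T R) (y : {RV P >-> R}) (alpha : R) : R :=
  generalized_inverse (cdf y) alpha.

Definition quantile_selections (d : measure_display) (T : measurableType d)
    (R : realType) (P : probability T R) (Y : T -> set R) (alpha q : R) :
    set {RV P >-> R} :=
  [set y : {RV P >-> R} | selections P Y y /\ quantile y alpha = q].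
Arguments quantile_selections {d T R} P Y alpha q _.

(* A set of extended reals, since 'E_P[_] is extended-real valued. An
   expectation of the indeterminate form +oo - +oo has value -oo, so
   membership in an interval with finite end points entails integrability. *)
Definition expectation_region (d : measure_display) (T : measurableType d)
    (R : realType) (P : probability T R) (Y : T -> set R) (alpha q : R) :
    set (\bar R) :=
  [set 'E_P[y] | y in quantile_selections P Y alpha q].

(* Main.v *)
Require Import Defs.
From HB Require Import structures.
From mathcomp Require Import all_boot all_order all_algebra.
From mathcomp Require Import all_classical all_reals all_analysis.
From mathcomp Require Import measurable_realfun.
Import Order.TTheory GRing.Theory Num.Theory.
Local Open Scope classical_set_scope.
Local Open Scope ring_scope.
Local Open Scope ereal_scope.

(** Almost surely the interval [yL, yU] is nonempty, so it meets ]-oo, t] iff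
    yL <= t and is contained in it iff yU <= t.  Hence the quantiles of the
    capacity and containment functionals are the ordinary quantiles of yL and
    yU, and the hypothesis on q says that q lies between the alpha-quantiles of
    the two end points.

    A selection with alpha-quantile q is q clamped to the interval,
    y = max(yL, min(q, yU)).  It satisfies y <= q as soon as yL <= q, and, for
    t < q, y <= t forces yU <= t.  So the distribution function of y is at least
    that of yL at q, and at most that of yU below q.  By the Galois connection
    between a distribution function and its quantile ([quantile_le]), the bound
    quantile yL <= q gives quantile y <= q, and q <= quantile yU forbids
    quantile y < q ([quantile_clamp]).

    The bounds on the expectation hold because a selection lies between yL and
    yU almost surely and the integral is monotone. *)

Lemma eq_measure_ae {d : measure_display} {T : measurableType d}
    {R : realType} (mu : {measure set T -> \bar R}) (A B : set T) :
  measurable A -> measurable B -> {ae mu, forall w, A w <-> B w} ->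
  mu A = mu B.
Proof.
move=> mA mB [N [mN N0 AB]].
rewrite -(measureU0 mA mN N0) -(measureU0 mB mN N0); congr (mu _).
apply/seteqP; split=> w [ABw|Nw]; try by right.
all: have [Nw|NNw] := pselect (N w); [by right|left].
all: by have : A w <-> B w by [apply: contrapT => nAB; exact/NNw/AB];
  move=> [? ?]; auto.
Qed.

Lemma measurable_le_fun {d : measure_display} {T : measurableType d}
    {R : realType} (f g : {mfun T >-> R}) : measurable [set w | (f w <= g w)%R].
Proof.
rewrite -[X in measurable X]setTI; under eq_set do rewrite -lee_fin.
by apply: measurable_lee => //; exact/measurable_EFinP.
Qed.

(** The positive parts are ordered almost surely as X and Y, the negative parts
    the other way, and subtraction of extended reals is monotone for infinite
    values too. *)
Lemma ae_le_expectation {d : measure_display} {T : measurableType d}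
    {R : realType} {P : probability T R} (X Y : {RV P >-> R}) :
  {ae P, forall w, (X w <= Y w)%R} -> 'E_P[X] <= 'E_P[Y].
Proof.
move=> XY; rewrite unlock integralE [leRHS]integralE.
have mE (Z : {RV P >-> R}) :
    measurable_fun [set: T] (fun w => (Z w)%:E : \bar R).
  exact/measurable_EFinP.
apply: leeB; apply: ae_ge0_le_integral => //; try exact: measurable_funepos;
  try exact: measurable_funeneg.
all: apply: filterS XY => w XYw _.
  by rewrite !funeposE ge_max !le_max lexx orbT andbT lee_fin XYw.
by rewrite !funenegE ge_max !le_max lexx orbT andbT leeN2 lee_fin XYw.
Qed.

Section cdf_clamp.
Context {d : measure_display} {T : measurableType d} {R : realType}.
Context {P : probability T R}.
Implicit Types X yL yU : {RV P >-> R}.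

Lemma measurable_sublevel X t : measurable [set w | (X w <= t)%R].
Proof. exact: (measurable_le_fun X (cst t)). Qed.

Lemma cdfE X t : cdf X t = P [set w | (X w <= t)%R].
Proof. by congr (P _); apply/seteqP; split=> w; rewrite /= in_itv. Qed.

Definition clamp yL yU (q : R) : {RV P >-> R} :=
  max_mfun yL (min_mfun (cst q) yU).

End cdf_clamp.

Section quantile.
Context {d : measure_display} {T : measurableType d} {R : realType}.
Context {P : probability T R} {alpha : R}.
Hypotheses (alpha_gt0 : (0 < alpha)%R) (alpha_lt1 : (alpha < 1)%R).

(** Together with [cdf_superlevel_has_lbound], this makes the infimum defining
    the quantile a true infimum instead of the default value of [inf]. If no
    point reached level alpha, the limit 1 at +oo would be at most alpha. *)
Lemma cdf_superlevel_nonempty (X : {RV P >-> R}) :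
  [set t | alpha%:E <= cdf X t] !=set0.
Proof.
apply: contrapT => noX; have : 1 <= alpha%:E; last first.
  by rewrite lee_fin leNgt alpha_lt1.
apply: cvge_le (cvg_cdfy1 X); apply: nearW => t.
by rewrite leNgt; apply/negP => /ltW aX; apply: noX; exists t.
Qed.

Lemma cdf_superlevel_has_lbound (X : {RV P >-> R}) :
  has_lbound [set t | alpha%:E <= cdf X t].
Proof.
apply: contrapT => noX; have : alpha%:E <= 0; last first.
  by rewrite lee_fin leNgt alpha_gt0.
apply: cvge_ge (cvg_cdfNy0 X); apply: nearW => s.
rewrite leNgt; apply/negP => Xs; apply: noX; exists s => t /= Xt.
rewrite leNgt; apply/negP => /ltW ts.
by have := lt_le_trans Xs (le_trans Xt (cdf_nondecreasing X ts)); rewrite ltxx.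
Qed.

(** Right-continuity of the distribution function makes the infimum defining
    the quantile a minimum. *)
Lemma quantile_le (X : {RV P >-> R}) (t : R) :
  (quantile X alpha <= t)%R = (alpha%:E <= cdf X t).
Proof.
apply/idP/idP => [Xt|Xt]; last first.
  exact: ge_inf (cdf_superlevel_has_lbound X) _ Xt.
have X_rc : cdf X s @[s --> t^'+] --> cdf X t.
  exact: cdf_right_continuous.
apply: cvge_ge X_rc.
near=> s; have ts : (t < s)%R by near: s; exact: nbhs_right_gt.
have [r /= Xr rs] := inf_lt (cdf_superlevel_nonempty X) (le_lt_trans Xt ts).
exact: le_trans Xr (cdf_nondecreasing X (ltW rs)).
Unshelve. all: by end_near. Qed.

Context {yL yU : {RV P >-> R}}.
Hypothesis yLU : {ae P, forall w, (yL w <= yU w)%R}.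

Let measurable_nonempty : measurable [set w | (yL w <= yU w)%R].
Proof. exact: measurable_le_fun. Qed.

(** The interval meets a left half-line iff it is nonempty and its lower end
    point lies in the half-line; nonemptiness holds almost surely. *)
Lemma capacity_quantileE :
  capacity_quantile P (random_interval yL yU) alpha = quantile yL alpha.
Proof.
congr generalized_inverse; apply/funext => t; rewrite cdfE /capacity.
have -> : [set w | random_interval yL yU w `&` `]-oo, t] !=set0] =
    [set w | (yL w <= yU w)%R] `&` [set w | (yL w <= t)%R].
  apply/seteqP; split=> w /=.
    move=> [x] []; rewrite /random_interval /= !in_itv /= => /andP[Lx xU] xt.
    by split; [exact: le_trans Lx xU|exact: le_trans Lx xt].
  move=> [LU Lt]; exists (yL w).
  by rewrite /random_interval /= !in_itv /= lexx.
apply: eq_measure_ae; [|exact: measurable_sublevel|].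
  by apply: measurableI => //; exact: measurable_sublevel.
by apply: filterS yLU => w LU; split=> [[]|].
Qed.

(** The empty interval is contained in every half-line, but it occurs only on a
    null set; elsewhere containment is decided by the upper end point. *)
Lemma containment_quantileE :
  containment_quantile P (random_interval yL yU) alpha = quantile yU alpha.
Proof.
congr generalized_inverse; apply/funext => t; rewrite cdfE /containment.
have -> : [set w | random_interval yL yU w `<=` `]-oo, t]] =
    ~` [set w | (yL w <= yU w)%R] `|` [set w | (yU w <= t)%R].
  apply/seteqP; split=> w /=.
    move=> Yt; have [LU|] := pselect (yL w <= yU w)%R; last by left.
    right; have := Yt (yU w).
    by rewrite /random_interval /= !in_itv /= LU lexx; exact.
  move=> [nLU|Ut] x; rewrite /random_interval /= !in_itv /= => /andP[Lx xU].
    by case: nLU; exact: le_trans Lx xU.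
  exact: le_trans xU Ut.
apply: eq_measure_ae; [|exact: measurable_sublevel|].
  by apply: measurableU; [exact: measurableC|exact: measurable_sublevel].
by apply: filterS yLU => w LU; split=> [[]|]; [|by []|right].
Qed.

Lemma selections_clamp q :
  selections P (random_interval yL yU) (clamp yL yU q).
Proof.
apply: filterS yLU => w LU; rewrite /random_interval /= in_itv /=.
by rewrite le_max lexx ge_max LU ge_min lexx orbT.
Qed.

(** Clamping q moves it above q only where yL > q, and below q only down to yU:
    at q the distribution function of the clamp dominates that of yL, and below
    q it is dominated by that of yU. *)
Lemma quantile_clamp q :
  (quantile yL alpha <= q)%R -> (q <= quantile yU alpha)%R ->
  quantile (clamp yL yU q) alpha = q.
Proof.
rewrite quantile_le => Lq qU; apply/le_anti/andP; split.
  rewrite quantile_le (le_trans Lq)// !cdfE.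
  rewrite le_measure ?inE//; try exact: measurable_sublevel.
  by move=> w /= Lw; rewrite ge_max Lw ge_min lexx.
(* Were the quantile t of the clamp below q, then yU would reach level alpha
   at t as well. *)
rewrite leNgt; apply/negP => yq; set t := quantile _ _ in yq.
suff : (quantile yU alpha <= t)%R by rewrite leNgt (lt_le_trans yq qU).
have : alpha%:E <= cdf (clamp yL yU q) t by rewrite -quantile_le.
rewrite quantile_le => /le_trans; apply; rewrite !cdfE.
rewrite le_measure ?inE//; try exact: measurable_sublevel.
move=> w /=.
by rewrite ge_max ge_min [(q <= t)%R]leNgt yq /= => /andP[].
Qed.

End quantile.

Theorem proposition2p23 (d : measure_display) (T : measurableType d)
    (R : realType) (P : probability T R)
    (P_complete : measure_is_complete P) (P_non_atomic : non_atomic P)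
    (yL yU : {RV P >-> R})
    (yL_le_yU : P [set w | (yL w <= yU w)%R] = 1)
    (integrable_Y : 'E_P[fun w => (`|yL w| + `|yU w|)%R] < +oo)
    (alpha : R) (alpha_gt0 : (0 < alpha)%R) (alpha_lt1 : (alpha < 1)%R)
    (q : R)
    (q_ge : (capacity_quantile P (random_interval yL yU) alpha <= q)%R)
    (q_le : (q <= containment_quantile P (random_interval yL yU) alpha)%R) :
  let Y := random_interval yL yU in
  [/\ quantile_selections P Y alpha q !=set0,
      (forall y : {RV P >-> R}, quantile_selections P Y alpha q y ->
         'E_P[y] \in `['E_P[yL], 'E_P[yU]]),
      expectation_region P Y alpha q !=set0 &
      expectation_region P Y alpha q `<=` `['E_P[yL], 'E_P[yU]]%classic].
Proof.
move=> Y.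
have yLU : {ae P, forall w, (yL w <= yU w)%R}.
  have mLU := measurable_le_fun yL yU.
  apply/negligibleP; first exact: measurableC.
  by rewrite [LHS]probability_setC// [X in 1 - X]yL_le_yU subee.
have yQ : quantile_selections P Y alpha q (clamp yL yU q).
  split; first exact: selections_clamp.
  rewrite (capacity_quantileE yLU) in q_ge.
  rewrite (containment_quantileE yLU) in q_le.
  exact: quantile_clamp.
have EY (y : {RV P >-> R}) : quantile_selections P Y alpha q y ->
    'E_P[y] \in `['E_P[yL], 'E_P[yU]].
  move=> [Yy _]; rewrite in_itv /=; apply/andP; split.
    apply: ae_le_expectation; apply: filterS Yy => w.
    by rewrite /Y /random_interval /= in_itv /= => /andP[].
  apply: ae_le_expectation; apply: filterS Yy => w.
  by rewrite /Y /random_interval /= in_itv /= => /andP[].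
split=> //.
- by exists (clamp yL yU q).
- by exists 'E_P[clamp yL yU q]; exists (clamp yL yU q).
- by move=> _ [y yY <-]; exact: EY.
Qed.
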